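(* Let $(\mathcal{X},d_{\mathcal{X}})$ and $(\mathcal{Y},d_{\mathcal{Y}})$ be separable metric spaces. For any random element $(X,Y)\sim\theta\in M_1^{1,1}(\mathcal{X}\times\mathcal{Y})$ with marginals $\mu\in M_1^1(\mathcal{X})$ and $\nu\in M_1^1(\mathcal{Y})$, it holds that $$|dcov(X,Y)|\le\sqrt{dcov(X,X)\,dcov(Y,Y)}\le D(\mu)D(\nu).$$ Furthermore, if both $(\mathcal{X},d_{\mathcal{X}})$ and $(\mathcal{Y},d_{\mathcal{Y}})$ are of negative type, then $dcov(X,Y)\ge 0$.
   Context: A metric space is of negative type if $\sum_{i,j=1}^n\alpha_i\alpha_j d(x_i,x_j)\le 0$ for all $n\in\mathbb{N}$, points $x_1,\dots,x_n$ and $\alpha\in\mathbb{R}^n$ with $\sum_i\alpha_i=0$. $M_1^1(\mathcal{X})$ is the set of Borel probability measures $\mu$ on $\mathcal{X}$ with $\int d_{\mathcal{X}}(x,o)\,d\mu(x)<\infty$ for some (equivalently every) $o\in\mathcal{X}$. $M_1^{1,1}(\mathcal{X}\times\mathcal{Y})$ is the set of probability measures on $\mathcal{B}(\mathcal{X})\otimes\mathcal{B}(\mathcal{Y})$ whose marginals lie in $M_1^1(\mathcal{X})$ and $M_1^1(\mathcal{Y})$. For $\mu\in M_1^1(\mathcal{X})$: $a_\mu(x)=\int d_{\mathcal{X}}(x,y)\,d\mu(y)$, $D(\mu)=\int a_\mu\,d\mu$, $d_\mu(x_1,x_2)=d_{\mathcal{X}}(x_1,x_2)-a_\mu(x_1)-a_\mu(x_2)+D(\mu)$,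 and analogously for $\nu$ on $\mathcal{Y}$. Let $(X',Y')$ be an independent copy of $(X,Y)$. Then $dcov(X,Y)=dcov(\theta)=E[d_\mu(X,X')d_\nu(Y,Y')]$, $dcov(X,X)=E[d_\mu(X,X')^2]$ and $dcov(Y,Y)=E[d_\nu(Y,Y')^2]$. *)

(* Defs.v *)
From HB Require Import structures.
From mathcomp Require Import all_boot all_order all_algebra.
From mathcomp Require Import all_classical all_reals all_analysis.

Set Implicit Arguments.
Unset Strict Implicit.
Unset Printing Implicit Defensive.

Import Order.TTheory GRing.Theory Num.Theory.
Import numFieldNormedType.Exports.

Local Open Scope classical_set_scope.
Local Open Scope ring_scope.

(* The library's measurable types are pointed, so a metric space carrying a
   sigma-algebra must be pointed too; this only excludes the empty space, on
   which there is no probability measure. *)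
#[short(type="pmetricType")]
HB.structure Definition PMetric (R : numDomainType) :=
  {T of Pointed T & Metric R T}.

Notation borel T := (g_sigma_algebraType (@open T)) (only parsing).

Definition separable (T : topologicalType) : Prop :=
  exists2 S : set T, countable S & dense S.

Definition negative_type (R : realType) (T : metricType R) : Prop :=
  forall (n : nat) (x : 'I_n -> T) (alpha : 'I_n -> R),
    \sum_(i < n) alpha i = 0 ->
    \sum_(i < n) \sum_(j < n) alpha i * alpha j * mdist (x i) (x j) <= 0.

Section OneSpace.
Context {R : realType} {T : pmetricType R}.
Implicit Type mu : probability (borel T) R.

Definition M11 mu : Prop :=
  exists o : T, (\int[mu]_x (mdist (x : T) o)%:E < +oo)%E.

Definition amu mu (x : T) : R := \int[mu]_y mdist x (y : T).

Definition Dmu mu : R := \int[mu]_x amu mu x.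

Definition dmu mu (x1 x2 : T) : R :=
  mdist x1 x2 - amu mu x1 - amu mu x2 + Dmu mu.

End OneSpace.

Section ProductMeasurability.
Context d d1 d2 (T : measurableType d) (T1 : measurableType d1)
  (T2 : measurableType d2).

HB.instance Definition _ :=
  isMeasurableFun.Build _ _ (T1 * T2)%type T1 (@fst T1 T2) measurable_fst.

HB.instance Definition _ :=
  isMeasurableFun.Build _ _ (T1 * T2)%type T2 (@snd T1 T2) measurable_snd.

Definition pair_fun (X : T -> T1) (Y : T -> T2) (w : T) : T1 * T2 := (X w, Y w).

Variables (X : {mfun T >-> T1}) (Y : {mfun T >-> T2}).

Let measurable_pair_fun : measurable_fun [set: T] (pair_fun X Y).
Proof. by apply: measurable_fun_pair; exact: measurable_funPT. Qed.

HB.instance Definition _ :=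
  isMeasurableFun.Build _ _ T (T1 * T2)%type (pair_fun X Y) measurable_pair_fun.

End ProductMeasurability.

Definition marginal1 d1 d2 (T1 : measurableType d1) (T2 : measurableType d2)
    (R : realType) (theta : probability (T1 * T2)%type R) : probability T1 R :=
  distribution theta (@fst T1 T2).

Definition marginal2 d1 d2 (T1 : measurableType d1) (T2 : measurableType d2)
    (R : realType) (theta : probability (T1 * T2)%type R) : probability T2 R :=
  distribution theta (@snd T1 T2).

Definition joint_law d d1 d2 (T : measurableType d) (T1 : measurableType d1)
    (T2 : measurableType d2) (R : realType) (P : probability T R)
    (X : {RV P >-> T1}) (Y : {RV P >-> T2}) : probability (T1 * T2)%type R :=
  distribution P (pair_fun X Y).
Arguments joint_law {d d1 d2 T T1 T2 R} P X Y.

Section TwoSpaces.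
Context {R : realType} {SX SY : pmetricType R}.
Implicit Type theta : probability (borel SX * borel SY)%type R.

Definition M111 theta : Prop := M11 (marginal1 theta) /\ M11 (marginal2 theta).

(* If (X, Y) has law theta and (X', Y') is an independent copy of it, then
   ((X, Y), (X', Y')) has law theta \x theta. The expectation is
   extended-real valued, so that finiteness is not built in. *)
Definition dcov_law theta : \bar R :=
  'E_(theta \x theta)[fun z =>
     (dmu (marginal1 theta) z.1.1 z.2.1 * dmu (marginal2 theta) z.1.2 z.2.2)%R]%E.

End TwoSpaces.

(* dcov P X X is the instance where the pair is (X, X): its law has both
   marginals equal to the law of X, whence E[d_mu(X, X')^2]. *)
Definition dcov (R : realType) (SX SY : pmetricType R)
    d (Omega : measurableType d) (P : probability Omega R)
    (X : {RV P >-> borel SX}) (Y : {RV P >-> borel SY}) : \bar R :=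
  dcov_law (joint_law P X Y).
Arguments dcov {R SX SY d Omega} P X Y.

(* Main.v *)
Require Import Defs.
From HB Require Import structures.
From mathcomp Require Import all_boot all_order all_algebra.
From mathcomp Require Import all_classical all_reals all_analysis.
From mathcomp Require Import measurable_realfun ring lra.

(** Composing the two metrics with X and Y turns the problem into one about two
    measurable pseudometrics K and L on the single probability space Omega:
    the distance covariance becomes the integral over P \x P of the product of
    the doubly centred kernels of K and L ([dcovE]). Separability enters only
    there: it makes a metric measurable for the product of the Borel
    sigma-algebras ([mdist_jointly_measurable]).

    Write a for the mean function of K, D for its total mean and c for its
    centred kernel. Only first moments are known to be finite, yet products of
    centred kernels are integrable: the triangle inequality yields
    D - 2 a <= c <= D <= 2 a and so bounds |c (x, y)| by 2 a (x) as well as by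
    2 a (y), hence a product of two centred kernels by a product of one
    integrable function of x and one of y ([dominated_kernel]).

    The first inequality is Cauchy-Schwarz. For the second, expand one factor
    of c^2. The terms c (x, y) a (x) and c (x, y) a (y) integrate to 0 since c
    is centred in each variable, so the integral of c^2 equals that of c K,
    and c <= D with K >= 0 bounds it by D^2 ([integral_centered_sq_le]).

    For nonnegativity no embedding in a Hilbert space is used. One sampling
    principle ([positive_definite_on_integral]) is applied twice: if a
    quadratic form is nonnegative on finite weighted configurations, then it
    stays so when some of the weight is spread over the space according to P.
    For -K, whose form is nonnegative on configurations of total weight zero,
    spreading the opposite of the total weight of an arbitrary configuration
    shows that -c is positive definite ([opp_centered_positive_definite]). By
    Schur's product theorem the product of the centred kernels of K and L is
    then positive definite, and spreading a unit weight over the space shows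
    that its integral is nonnegative. This second use requires an integrable
    diagonal, which holds after truncation to the sets where a is bounded;
    dominated convergence removes the truncation
    ([integral_centered_mul_ge0]). *)

Set Implicit Arguments.
Unset Strict Implicit.
Unset Printing Implicit Defensive.

Import Order.TTheory GRing.Theory Num.Theory.
Import numFieldNormedType.Exports.

Local Open Scope classical_set_scope.
Local Open Scope ring_scope.

(** * Quadratic forms on finite weighted configurations *)

Section QuadraticForms.
Context {R : realFieldType} {T : Type}.
Implicit Types (K : T -> T -> R) (s : seq (T * R)).

(** A finite weighted configuration is a sequence of pairs (point, weight);
    points may repeat, so that samples can be added one at a time. *)
Definition total_weight s : R := \sum_(p <- s) p.2.

Definition potential (f : T -> R) s : R := \sum_(p <- s) p.2 * f p.1.

Definition quad_form K s : R :=
  \sum_(p <- s) \sum_(q <- s) p.2 * q.2 * K p.1 q.1.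

(** The predicate A restricts the total weight: a metric is of negative type
    when its opposite is positive definite on [fun t => t = 0]. *)
Definition positive_definite_on (A : R -> Prop) K :=
  forall s, A (total_weight s) -> 0 <= quad_form K s.

Definition positive_definite K := positive_definite_on (fun=> True) K.

Lemma quad_form_nil K : quad_form K [::] = 0.
Proof. by rewrite /quad_form big_nil. Qed.

Lemma quad_form_cons K p s : (forall x y, K x y = K y x) ->
  quad_form K (p :: s) =
  quad_form K s + 2 * p.2 * potential (K p.1) s + p.2 ^+ 2 * K p.1 p.1.
Proof.
move=> Ksym; rewrite /quad_form /potential big_cons.
under [X in _ + X = _]eq_bigr do rewrite big_cons.
rewrite big_cons big_split/=.
have -> : \sum_(q <- s) q.2 * p.2 * K q.1 p.1 =
    p.2 * \sum_(q <- s) q.2 * K p.1 q.1.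
  by rewrite mulr_sumr; apply: eq_bigr => q _; rewrite Ksym; ring.
have -> : \sum_(q <- s) p.2 * q.2 * K p.1 q.1 =
    p.2 * \sum_(q <- s) q.2 * K p.1 q.1.
  by rewrite mulr_sumr; apply: eq_bigr => q _; ring.
ring.
Qed.

Lemma quad_formD K L s :
  quad_form (fun x y => K x y + L x y) s = quad_form K s + quad_form L s.
Proof.
rewrite /quad_form -big_split; apply: eq_bigr => p _.
by rewrite -big_split; apply: eq_bigr => q _ /=; rewrite mulrDr.
Qed.

Lemma quad_formZ (a : R) K s :
  quad_form (fun x y => a * K x y) s = a * quad_form K s.
Proof.
rewrite /quad_form mulr_sumr; apply: eq_bigr => p _.
by rewrite mulr_sumr; apply: eq_bigr => q _ /=; ring.
Qed.

Lemma quad_form_reweight (w : T -> R) K s :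
  quad_form (fun x y => w x * w y * K x y) s =
  quad_form K [seq (p.1, p.2 * w p.1) | p <- s].
Proof.
rewrite /quad_form big_map; apply: eq_bigr => p _.
by rewrite big_map; apply: eq_bigr => q _ /=; ring.
Qed.

Lemma positive_definite_reweight (w : T -> R) K : positive_definite K ->
  positive_definite (fun x y => w x * w y * K x y).
Proof. by move=> Kpd s _; rewrite quad_form_reweight; exact: Kpd. Qed.

Lemma quad_form_rank1 (f : T -> R) s :
  quad_form (fun x y => f x * f y) s = potential f s ^+ 2.
Proof.
rewrite expr2 {1}/potential mulr_suml; apply: eq_bigr => p _.
by rewrite mulr_sumr; apply: eq_bigr => q _ /=; ring.
Qed.

Lemma quad_form_sum1 (f : T -> R) s :
  quad_form (fun x y => f x + f y) s = 2 * total_weight s * potential f s.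
Proof.
rewrite quad_formD.
suff [-> ->] : quad_form (fun x _ => f x) s = total_weight s * potential f s /\
    quad_form (fun _ y => f y) s = total_weight s * potential f s by ring.
rewrite /quad_form; split.
  rewrite mulrC mulr_suml; apply: eq_bigr => p _.
  by rewrite mulr_sumr; apply: eq_bigr => q _; ring.
rewrite mulr_suml; apply: eq_bigr => p _.
by rewrite mulr_sumr; apply: eq_bigr => q _; ring.
Qed.

Lemma quad_form_cst (a : R) s :
  quad_form (fun _ _ => a) s = total_weight s ^+ 2 * a.
Proof.
rewrite expr2 -mulrA mulr_suml; apply: eq_bigr => p _.
by rewrite mulr_suml mulr_sumr; apply: eq_bigr => q _; ring.
Qed.

Lemma positive_definite_diag_ge0 K x : positive_definite K -> 0 <= K x x.
Proof.
move=> /(_ [:: (x, 1)] Logic.I).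
by rewrite /quad_form !big_cons !big_nil /= !addr0 !mul1r.
Qed.

(** The form of the pair (x, t), (y, 1) is affine in t when K x x = 0, so it
    is bounded below only if its slope vanishes. *)
Lemma positive_definite_diag0 K x y : (forall x y, K x y = K y x) ->
  positive_definite K -> K x x = 0 -> K x y = 0.
Proof.
move=> Ksym Kpd Kxx.
have H t : 0 <= K y y + 2 * t * K x y.
  have := Kpd [:: (x, t); (y, 1)] Logic.I.
  rewrite !quad_form_cons// quad_form_nil /potential !big_cons !big_nil /= Kxx.
  by rewrite !mulr0 !mul1r !expr1n !add0r !mul1r !addr0.
(* At this t the form would equal -1. *)
have := H (- (K y y + 1) / (2 * K x y)).
have [->//|Kxy0] := eqVneq (K x y) 0.
have -> : 2 * (- (K y y + 1) / (2 * K x y)) * K x y = - (K y y + 1) by field.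
lra.
Qed.

(** One step of symmetric Gaussian elimination. The reduced form of s is the
    form of s with x0 adjoined, at the weight that minimises it. When
    K x0 x0 = 0 the convention 0^-1 = 0 makes the step trivial. *)
Lemma positive_definite_pivot K x0 : (forall x y, K x y = K y x) ->
  positive_definite K ->
  positive_definite (fun x y => K x y - K x x0 * K x0 y / K x0 x0).
Proof.
move=> Ksym Kpd.
have [K0|K0] := eqVneq (K x0 x0) 0.
  move=> s _; rewrite (_ : quad_form _ _ = quad_form K s); first exact: Kpd.
  congr (quad_form _ s); apply/funext => x; apply/funext => y.
  by rewrite K0 invr0 mulr0 subr0.
move=> s _.
have := Kpd ((x0, - potential (K x0) s / K x0 x0) :: s) Logic.I.
rewrite quad_form_cons//=.
rewrite (_ : (fun x y => _) = fun x y =>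
    K x y + (- (K x0 x0)^-1) * (K x0 x * K x0 y)); last first.
  by apply/funext => x; apply/funext => y; rewrite (Ksym x x0); field.
rewrite quad_formD quad_formZ quad_form_rank1.
by congr (0 <= _); field.
Qed.

End QuadraticForms.

(** Schur's product theorem. Eliminating the points of the configuration one
    after the other writes K as a sum of rank-one kernels f (x) f (y) with
    nonnegative coefficients, up to a remainder vanishing at these points; and
    f (x) f (y) L (x, y) is L with its weights multiplied by f. *)
Lemma schur_product (R : realFieldType) (T : eqType) (K L : T -> T -> R) :
  (forall x y, K x y = K y x) -> (forall x y, L x y = L y x) ->
  positive_definite K -> positive_definite L ->
  positive_definite (fun x y => K x y * L x y).
Proof.
move=> Ksym Lsym Kpd Lpd s _.
(* Points move from s2 to s1 as they are eliminated: K vanishes on the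
   diagonal at the points of s1. *)
suff {s K Ksym Kpd} H s2 s1 K : (forall x y, K x y = K y x) ->
    positive_definite K -> {in s1, forall p, K p.1 p.1 = 0} ->
    0 <= quad_form (fun x y => K x y * L x y) (s1 ++ s2).
  by apply: (H s [::]).
elim: s2 s1 K => [|p s2 IH] s1 K Ksym Kpd K0.
  rewrite cats0 /quad_form big1_seq// => p /= ps1.
  rewrite big1// => q _.
  by rewrite (positive_definite_diag0 _ Ksym Kpd (K0 _ ps1)) mul0r mulr0.
rewrite -cat_rcons.
pose K' x y := K x y - K x p.1 * K p.1 y / K p.1 p.1.
have K'sym x y : K' x y = K' y x.
  by rewrite /K' (Ksym x y) (Ksym x p.1) (Ksym y p.1) (mulrC (K p.1 x)).
have K'p : K' p.1 p.1 = 0.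
  rewrite /K'; have [->|?] := eqVneq (K p.1 p.1) 0.
    by rewrite !mul0r subr0.
  by rewrite mulfK// subrr.
have K'0 : {in rcons s1 p, forall q, K' q.1 q.1 = 0}.
  move=> q; rewrite mem_rcons inE => /predU1P[->//|/K0 Kq].
  by rewrite /K' Kq (positive_definite_diag0 _ Ksym Kpd Kq) !mul0r subr0.
have := IH (rcons s1 p) K' K'sym (positive_definite_pivot _ Ksym Kpd) K'0.
set s := rcons s1 p ++ s2 => K's.
rewrite (_ : (fun x y => _) = fun x y => K' x y * L x y +
    (K p.1 p.1)^-1 * (K p.1 x * K p.1 y * L x y)); last first.
  by apply/funext => x; apply/funext => y; rewrite /K' (Ksym x p.1); ring.
rewrite quad_formD quad_formZ addr_ge0// mulr_ge0//.
  by rewrite invr_ge0 (positive_definite_diag_ge0 _ Kpd).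
exact: (positive_definite_reweight _ Lpd).
Qed.

(** * Real integrals and dominated kernels *)

Section RealIntegrable.
Context d (T : measurableType d) (R : realType).
Variable mu : {measure set T -> \bar R}.
Implicit Types f g : T -> R.

Definition rintegrable f := mu.-integrable setT (EFin \o f).

Lemma rintegrable_measurable f : rintegrable f -> measurable_fun setT f.
Proof. by move=> /measurable_int /measurable_EFinP. Qed.

Lemma rintegrable_le f g : measurable_fun setT f ->
  (forall x, `|f x| <= g x) -> rintegrable g -> rintegrable f.
Proof.
move=> mf fg; apply: le_integrable => //; first exact/measurable_EFinP.
by move=> x _ /=; rewrite lee_fin (le_trans (fg x))// ler_norm.
Qed.

Lemma rintegrableD f g : rintegrable f -> rintegrable g ->
  rintegrable (fun x => f x + g x).
Proof. by move=> fi gi; exact: (integrableD measurableT fi gi). Qed.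

Lemma rintegrableB f g : rintegrable f -> rintegrable g ->
  rintegrable (fun x => f x - g x).
Proof. by move=> fi gi; exact: (integrableB measurableT fi gi). Qed.

Lemma rintegrableZ (k : R) f : rintegrable f -> rintegrable (fun x => k * f x).
Proof. by move=> fi; exact: (integrableZl measurableT k fi). Qed.

Lemma rintegrable_norm f : rintegrable f -> rintegrable (fun x => `|f x|).
Proof. by move=> /integrable_norm. Qed.

Lemma rintegrable_sum I (s : seq I) (F : I -> T -> R) :
  (forall i, rintegrable (F i)) -> rintegrable (fun x => \sum_(i <- s) F i x).
Proof.
move=> Fi; elim: s => [|i s IH].
  rewrite /rintegrable (_ : EFin \o _ = cst 0%E); first exact: integrable0.
  by apply/funext => x /=; rewrite big_nil.
rewrite /rintegrable (_ : EFin \o _ =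
    (EFin \o (fun x => F i x + \sum_(i <- s) F i x))).
  exact: rintegrableD.
by apply/funext => x /=; rewrite big_cons.
Qed.

Lemma EFin_Rintegral f : rintegrable f ->
  (\int[mu]_x f x)%:E = (\int[mu]_x (f x)%:E)%E.
Proof.
by move=> fi; rewrite fineK//; exact: (integrable_fin_num measurableT fi).
Qed.

Lemma RintegralDT f g : rintegrable f -> rintegrable g ->
  \int[mu]_x (f x + g x) = \int[mu]_x f x + \int[mu]_x g x.
Proof. exact: RintegralD. Qed.

Lemma RintegralBT f g : rintegrable f -> rintegrable g ->
  \int[mu]_x (f x - g x) = \int[mu]_x f x - \int[mu]_x g x.
Proof. exact: RintegralB. Qed.

Lemma RintegralZT k f : rintegrable f ->
  \int[mu]_x (k * f x) = k * \int[mu]_x f x.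
Proof. exact: RintegralZl. Qed.

Lemma le_RintegralT f g : rintegrable f -> rintegrable g ->
  (forall x, f x <= g x) -> \int[mu]_x f x <= \int[mu]_x g x.
Proof. by move=> fi gi fg; apply: le_Rintegral. Qed.

Lemma Rintegral_sumT I (s : seq I) (F : I -> T -> R) :
  (forall i, rintegrable (F i)) ->
  \int[mu]_x (\sum_(i <- s) F i x) = \sum_(i <- s) \int[mu]_x F i x.
Proof.
move=> Fi; elim: s => [|i s IH].
  rewrite big_nil (_ : (fun x => _) = cst 0); last first.
    by apply/funext => x; rewrite big_nil.
  by rewrite Rintegral_cst// mul0r.
rewrite big_cons -IH -RintegralDT//; last exact: rintegrable_sum.
by congr Rintegral; apply/funext => x; rewrite big_cons.
Qed.

End RealIntegrable.

Section ProbabilityIntegrable.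
Context d (T : measurableType d) (R : realType) (P : probability T R).

Lemma rintegrable_cst (k : R) : rintegrable P (fun=> k).
Proof. exact: (finite_measure_integrable_cst P k measurableT). Qed.

Lemma Rintegral_cstT (k : R) : \int[P]_x k = k.
Proof. by rewrite Rintegral_cst//= probability_setT mulr1. Qed.

End ProbabilityIntegrable.

(** The integrands of the proof are dominated by products of one integrable
    function of each variable. This is enough for Fubini's theorem, and unlike
    integrability on the product space it makes every section integrable, not
    just almost every one, so that real-valued iterated integrals can be used
    pointwise. *)
Section DominatedKernels.
Context d (T : measurableType d) (R : realType) (P : probability T R).
Implicit Types H : T -> T -> R.

Definition jointly_measurable H :=
  measurable_fun [set: T * T] (fun z : T * T => H z.1 z.2).

Record dominated_kernel H : Prop := DominatedKernel {
  dominated_measurable : jointly_measurable H ;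
  dominated_bound : exists f g : T -> R, [/\ rintegrable P f, rintegrable P g &
    forall x y, `|H x y| <= f x * g y] }.

Lemma jointly_measurable_section H x :
  jointly_measurable H -> measurable_fun setT (H x).
Proof.
by move=> mH; exact: (measurableT_comp mH (measurable_pair1 x)).
Qed.

Lemma jointly_measurable_swap H : jointly_measurable H ->
  jointly_measurable (fun x y => H y x).
Proof.
by move=> mH; exact: (measurableT_comp mH (@measurable_swap _ _ T T)).
Qed.

Lemma jointly_measurable_diag H : jointly_measurable H ->
  measurable_fun setT (fun x => H x x).
Proof.
move=> mH; have mdiag : measurable_fun setT (fun x : T => (x, x)).
  exact: measurable_fun_pair.
exact: (measurableT_comp mH mdiag).
Qed.

Lemma jointly_measurableM H H' :
  jointly_measurable H -> jointly_measurable H' ->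
  jointly_measurable (fun x y => H x y * H' x y).
Proof. exact: measurable_funM. Qed.

Lemma jointly_measurable_fun1 (f : T -> R) : measurable_fun setT f ->
  jointly_measurable (fun x _ => f x).
Proof. by move=> mf; exact: measurableT_comp. Qed.

Lemma jointly_measurable_fun2 (f : T -> R) : measurable_fun setT f ->
  jointly_measurable (fun _ y => f y).
Proof. by move=> mf; exact: measurableT_comp. Qed.

Lemma dominated_kernel_swap H : dominated_kernel H ->
  dominated_kernel (fun x y => H y x).
Proof.
move=> [mH [f [g [fi gi fg]]]]; split; first exact: jointly_measurable_swap.
by exists g, f; split=> // x y; rewrite mulrC.
Qed.

Lemma dominated_section H x : dominated_kernel H -> rintegrable P (H x).
Proof.
move=> [mH [f [g [fi gi fg]]]].
apply: (@rintegrable_le _ _ _ _ _ (fun y => f x * g y)) => //.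
  exact: jointly_measurable_section.
exact: rintegrableZ.
Qed.

Lemma dominated_integrable H : dominated_kernel H ->
  rintegrable (P \x P)%E (fun z => H z.1 z.2).
Proof.
move=> [mH [f [g [fi gi fg]]]].
apply/integrable12ltyP; first exact/measurable_EFinP.
have nfi := rintegrable_norm fi; have ngi := rintegrable_norm gi.
apply: (@le_lt_trans _ _ (\int[P]_x (`|f x| * \int[P]_y `|g y|)%:E)%E).
  apply: ge0_le_integral => //.
  - by move=> x _; exact: integral_ge0.
  - apply: (measurable_fun_fubini_tonelli_F
      (fun z => `|(H z.1 z.2)%:E|)%E) => //.
    by apply: measurableT_comp => //; exact/measurable_EFinP.
  - apply/measurable_EFinP; apply: measurable_funM => //.
    exact: rintegrable_measurable nfi.
  - move=> x _; rewrite -RintegralZT// EFin_Rintegral; last exact: rintegrableZ.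
    apply: ge0_le_integral => //.
    + apply/measurable_EFinP; apply: measurableT_comp => //.
      exact: jointly_measurable_section.
    + apply/measurable_EFinP; apply: measurable_funM => //.
      exact: rintegrable_measurable ngi.
    + move=> y _; rewrite lee_fin -normrM (le_trans (fg x y))//.
      exact: ler_norm.
rewrite -EFin_Rintegral ?ltry//.
rewrite (_ : (fun x => _) = fun x => (\int[P]_y `|g y|) * `|f x|).
  exact: rintegrableZ.
by apply/funext => x; rewrite mulrC.
Qed.

Lemma dominated_integral_section H : dominated_kernel H ->
  rintegrable P (fun x => \int[P]_y H x y).
Proof.
move=> Hd; have := integrable_fubini_F (dominated_integrable Hd).
congr (integrable _ _ _); apply/funext => x /=.
by rewrite EFin_Rintegral//; exact: dominated_section.
Qed.

Lemma dominated_fubini H : dominated_kernel H ->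
  \int[(P \x P)%E]_z H z.1 z.2 = \int[P]_x \int[P]_y H x y.
Proof.
move=> Hd; rewrite /Rintegral.
rewrite -(integral12_prod_meas1 (dominated_integrable Hd)).
congr fine; apply: eq_integral => x _.
by rewrite EFin_Rintegral//; exact: dominated_section.
Qed.

Lemma dominated_fubini_swap H : dominated_kernel H ->
  \int[(P \x P)%E]_z H z.1 z.2 = \int[P]_y \int[P]_x H x y.
Proof.
move=> Hd; rewrite /Rintegral.
rewrite -(integral21_prod_meas1 (dominated_integrable Hd)).
congr fine; apply: eq_integral => y _.
rewrite EFin_Rintegral//.
exact: (dominated_section y (dominated_kernel_swap Hd)).
Qed.

End DominatedKernels.

(** * Spreading weight over a probability space *)

Lemma ge0_archimedean_perturbation (R : realType) (a b : R) :
  (forall n : nat, 0 <= a + b / n.+1%:R) -> 0 <= a.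
Proof.
move=> H; rewrite leNgt; apply/negP => a0.
have na0 : 0 < - a by rewrite oppr_gt0.
have := archi_boundP (normr_ge0 (b / - a)); set n := Num.bound _ => bn.
have n0 : 0 < n.+1%:R :> R by rewrite ltr0n.
have nn : n%:R <= n.+1%:R :> R by rewrite ler_nat.
have : b / - a < n.+1%:R.
  exact: le_lt_trans (ler_norm _) (lt_le_trans bn nn).
rewrite ltr_pdivrMr// mulrC -ltr_pdivrMr// => bna.
have : a + b / n.+1%:R < 0 by rewrite -(subrr a) ltrD2l.
by rewrite ltNge H.
Qed.

(** The n-fold expectation behind the law of large numbers is replaced by an
    induction: integrating the inequality for a configuration with one more
    point (y, b) against P (dy) adds one random sample of weight b. *)
Section Sampling.
Context d (T : measurableType d) (R : realType) (P : probability T R).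
Variables (A : R -> Prop) (K : T -> T -> R).
Hypothesis Ksym : forall x y, K x y = K y x.
Hypothesis Kpd : positive_definite_on A K.
Hypothesis Ksection : forall x, rintegrable P (K x).
Hypothesis Kmean : rintegrable P (fun x => \int[P]_y K x y).
Hypothesis Kdiag : rintegrable P (fun x => K x x).

Let k x := \int[P]_y K x y.
Let E := \int[P]_x k x.
Let c := \int[P]_x K x x.

Let potential_rintegrable s : rintegrable P (fun y => potential (K y) s).
Proof.
apply: rintegrable_sum => p; apply: rintegrableZ.
rewrite (_ : (fun x => _) = K p.1); first exact: Ksection.
by apply/funext => y; rewrite Ksym.
Qed.

Let Rintegral_potential s : \int[P]_y potential (K y) s = potential k s.
Proof.
rewrite Rintegral_sumT => [|p].
  apply: eq_bigr => p _; rewrite RintegralZT; last first.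
    rewrite (_ : (fun x => _) = K p.1); first exact: Ksection.
    by apply/funext => y; rewrite Ksym.
  by congr (_ * _); congr Rintegral; apply/funext => y; rewrite Ksym.
apply: rintegrableZ.
rewrite (_ : (fun x => _) = K p.1); first exact: Ksection.
by apply/funext => y; rewrite Ksym.
Qed.

(** Expected value of the form after adding n independent samples of weight b:
    c is the diagonal contribution of a sample, E that of two distinct ones. *)
Lemma quad_form_add_samples n s b : A (total_weight s + n%:R * b) ->
  0 <= quad_form K s + 2 * n%:R * b * potential k s + n%:R * b ^+ 2 * c
       + (n%:R ^+ 2 - n%:R) * b ^+ 2 * E.
Proof.
elim: n s => [|n IH] s As.
  rewrite mulr0n mul0r addr0 in As.
  rewrite mulr0n expr0n/= subr0 !(mulr0, mul0r, addr0); exact: Kpd.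
pose u := quad_form K s + 2 * n%:R * b * potential k s + n%:R * b ^+ 2 * c
       + (n%:R ^+ 2 - n%:R) * b ^+ 2 * E.
pose G y := u + (2 * b * potential (K y) s + (b ^+ 2 * K y y
    + 2 * n%:R * b ^+ 2 * k y)).
have G0 y : 0 <= G y.
  have := IH ((y, b) :: s); rewrite quad_form_cons//.
  have -> : total_weight ((y, b) :: s) + n%:R * b =
      total_weight s + n.+1%:R * b.
    by rewrite /total_weight big_cons -natr1/=; ring.
  move=> /(_ As); congr (0 <= _).
  have -> : potential k ((y, b) :: s) = b * k y + potential k s.
    by rewrite /potential big_cons.
  by rewrite /G /u /=; ring.
have := @Rintegral_ge0 _ _ _ P setT G (fun y _ => G0 y).
have i1 : rintegrable P (fun y => b ^+ 2 * K y y) by exact: rintegrableZ.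
have i2 : rintegrable P (fun y => 2 * n%:R * b ^+ 2 * k y).
  exact: rintegrableZ.
have i3 : rintegrable P (fun y => 2 * b * potential (K y) s).
  exact: rintegrableZ.
have i4 := rintegrableD i1 i2.
have i5 := rintegrableD i3 i4.
rewrite /G RintegralDT//; last exact: rintegrable_cst.
rewrite Rintegral_cstT RintegralDT// RintegralDT// !RintegralZT//.
rewrite Rintegral_potential.
by rewrite -/c -/E /u -natr1; congr (0 <= _); ring.
Qed.

(** Spread the weight t over n samples of weight t / n: their diagonal terms
    contribute t^2 / n times c, which vanishes in the limit. *)
Lemma positive_definite_on_integral s t : A (total_weight s + t) ->
  0 <= quad_form K s + 2 * t * potential k s + t ^+ 2 * E.
Proof.
move=> As; apply: (@ge0_archimedean_perturbation _ _ (t ^+ 2 * (c - E))) => n.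
have n0 : n.+1%:R != 0 :> R by rewrite pnatr_eq0.
have := @quad_form_add_samples n.+1 s (t / n.+1%:R).
rewrite mulrCA divff// mulr1 => /(_ As); congr (0 <= _); field.
by rewrite addrC natr1.
Qed.

End Sampling.

Lemma positive_definite_integral_ge0 d (T : measurableType d) (R : realType)
    (P : probability T R) (K : T -> T -> R) :
  (forall x y, K x y = K y x) -> positive_definite K ->
  (forall x, rintegrable P (K x)) ->
  rintegrable P (fun x => \int[P]_y K x y) ->
  rintegrable P (fun x => K x x) ->
  0 <= \int[P]_x \int[P]_y K x y.
Proof.
move=> Ksym Kpd Ks Km Kd.
have := positive_definite_on_integral Ksym Kpd Ks Km Kd
  (s := [::]) (t := 1) Logic.I.
by rewrite quad_form_nil /potential big_nil mulr0 expr1n mul1r !add0r.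
Qed.

(** * Double centring of a pseudometric *)

Section Centering.
Context d (T : measurableType d) (R : realType) (P : probability T R).
Implicit Types K : T -> T -> R.

Definition kernel_mean K x : R := \int[P]_y K x y.

Definition kernel_total K : R := \int[P]_x kernel_mean K x.

Definition centered K x y : R :=
  K x y - kernel_mean K x - kernel_mean K y + kernel_total K.

(** A pseudometric rather than a metric, since X w = X w' does not imply
    w = w'. *)
Record integrable_pseudometric K : Prop := IntegrablePseudometric {
  pseudometric_measurable : jointly_measurable K ;
  pseudometric_diag : forall x, K x x = 0 ;
  pseudometric_sym : forall x y, K x y = K y x ;
  pseudometric_triangle : forall x y z, K x z <= K x y + K y z ;
  pseudometric_section : forall x, rintegrable P (K x) }.

Variable K : T -> T -> R.
Hypothesis Kdist : integrable_pseudometric K.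

Let a := kernel_mean K.
Let D := kernel_total K.
Let Kxx := pseudometric_diag Kdist.
Let Ksym := pseudometric_sym Kdist.
Let Ktri := pseudometric_triangle Kdist.
Let Ksec := pseudometric_section Kdist.

Let pseudometric_ge0 x y : 0 <= K x y.
Proof. by have := Ktri x y x; rewrite Kxx (Ksym y x); lra. Qed.

Lemma kernel_mean_ge0 x : 0 <= a x.
Proof. by apply: Rintegral_ge0 => y _; exact: pseudometric_ge0. Qed.

Let mean_shift x y : a x <= K x y + a y.
Proof.
have := @le_RintegralT _ _ _ P (K x) (fun z => K x y + K y z) (Ksec x)
  (rintegrableD (rintegrable_cst P (K x y)) (Ksec y)) (Ktri x y).
by rewrite RintegralDT// ?Rintegral_cstT//; exact: rintegrable_cst.
Qed.

(** Tonelli's theorem for nonnegative functions is used because the domination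
    of K by products needs the integrability of its mean. *)
Lemma kernel_mean_measurable : measurable_fun setT a.
Proof.
apply: (measurableT_comp (f := fine)) => //.
apply: (measurable_fun_fubini_tonelli_F (fun z : T * T => (K z.1 z.2)%:E)).
  by apply/measurable_EFinP; exact: pseudometric_measurable Kdist.
by move=> z; rewrite lee_fin.
Qed.

Lemma kernel_mean_rintegrable : rintegrable P a.
Proof.
pose o : T := point.
apply: (@rintegrable_le _ _ _ _ _ (fun x => K o x + a o)).
- exact: kernel_mean_measurable.
- by move=> x; rewrite ger0_norm ?kernel_mean_ge0// (Ksym o x).
- exact: rintegrableD (Ksec o) (rintegrable_cst P (a o)).
Qed.

Let ia := kernel_mean_rintegrable.

Lemma kernel_total_ge0 : 0 <= D.
Proof. by apply: Rintegral_ge0 => x _; exact: kernel_mean_ge0. Qed.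

Let le_mean_mean x y : K x y <= a x + a y.
Proof.
have := @le_RintegralT _ _ _ P (fun=> K x y) (fun z => K x z + K y z)
  (rintegrable_cst P (K x y)) (rintegrableD (Ksec x) (Ksec y)).
rewrite RintegralDT// Rintegral_cstT; apply => z.
by rewrite (Ksym y z).
Qed.

(* The integral of a y <= K x y + a x over y. *)
Let total_le_mean x : D <= 2 * a x.
Proof.
have := @le_RintegralT _ _ _ P a (fun y => K x y + a x)
  ia (rintegrableD (Ksec x) (rintegrable_cst P (a x))).
rewrite RintegralDT// ?Rintegral_cstT; last exact: rintegrable_cst.
rewrite -/(a x) mulr_natl mulr2n; apply => y.
by rewrite (Ksym x y).
Qed.

Lemma centered_sym x y : centered K x y = centered K y x.
Proof. by rewrite /centered (Ksym x y); ring. Qed.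

(** The integral over z of K x y <= K x z + K z y is K x y <= a x + a y. *)
Lemma centered_le x y : centered K x y <= D.
Proof. by rewrite /centered -/a -/D; have := le_mean_mean x y; lra. Qed.

(** From above, c <= D <= 2 a x. From below, a y <= K x y + a x gives
    c >= D - 2 a x >= - 2 a x. *)
Lemma centered_norm_le1 x y : `|centered K x y| <= 2 * a x.
Proof.
rewrite ler_norml; apply/andP; split; last first.
  exact: le_trans (centered_le x y) (total_le_mean x).
rewrite /centered -/a -/D; have := mean_shift y x; rewrite (Ksym y x).
have := kernel_total_ge0; lra.
Qed.

Lemma centered_norm_le2 x y : `|centered K x y| <= 2 * a y.
Proof. by rewrite centered_sym centered_norm_le1. Qed.

Lemma centered_measurable : jointly_measurable (centered K).
Proof.
apply: measurable_funD => //; apply: measurable_funB.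
  apply: measurable_funB; first exact: pseudometric_measurable Kdist.
  exact: jointly_measurable_fun1 kernel_mean_measurable.
exact: jointly_measurable_fun2 kernel_mean_measurable.
Qed.

Lemma centered_dominated : dominated_kernel P (centered K).
Proof.
split; first exact: centered_measurable.
exists (fun x => 2 * a x), (fun=> 1); split.
- exact: rintegrableZ.
- exact: rintegrable_cst.
- by move=> x y; rewrite mulr1 centered_norm_le1.
Qed.

Lemma pseudometric_dominated : dominated_kernel P K.
Proof.
split; first exact: pseudometric_measurable Kdist.
exists (fun x => 1 + a x), (fun x => 1 + a x); split.
- exact: rintegrableD (rintegrable_cst P 1) ia.
- exact: rintegrableD (rintegrable_cst P 1) ia.
- move=> x y; rewrite ger0_norm// (le_trans (le_mean_mean x y))//.
  have -> : (1 + a x) * (1 + a y) = a x + a y + (1 + a x * a y) by ring.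
  by rewrite lerDl addr_ge0// mulr_ge0// kernel_mean_ge0.
Qed.

Lemma centered_mean0 x : \int[P]_y centered K x y = 0.
Proof.
have i1 := rintegrableB (Ksec x) (rintegrable_cst P (a x)).
have i2 := rintegrableB i1 ia.
rewrite /centered RintegralDT//; last exact: rintegrable_cst.
rewrite RintegralBT// RintegralBT//; last exact: rintegrable_cst.
by rewrite !Rintegral_cstT subrr sub0r addNr.
Qed.

Lemma centered_mul_mean_dominated :
  dominated_kernel P (fun x y => a x * centered K x y).
Proof.
split.
  exact: jointly_measurableM (jointly_measurable_fun1 kernel_mean_measurable)
    centered_measurable.
exists a, (fun y => 2 * a y); split=> //; first exact: rintegrableZ.
move=> x y; rewrite normrM ger0_norm ?kernel_mean_ge0//.
by rewrite ler_wpM2l ?kernel_mean_ge0// centered_norm_le2.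
Qed.

Let integral_centered_mul_mean :
  \int[(P \x P)%E]_z (a z.1 * centered K z.1 z.2) = 0.
Proof.
rewrite (dominated_fubini centered_mul_mean_dominated).
rewrite (_ : (fun x => _) = fun=> 0) ?Rintegral_cstT//; apply/funext => x.
rewrite RintegralZT; last exact: (dominated_section x centered_dominated).
by rewrite centered_mean0 mulr0.
Qed.

Let integral_centered_mul_mean_swap :
  \int[(P \x P)%E]_z (a z.2 * centered K z.1 z.2) = 0.
Proof.
have dswap := dominated_kernel_swap centered_mul_mean_dominated.
transitivity (\int[(P \x P)%E]_z (a z.2 * centered K z.2 z.1)).
  by congr Rintegral; apply/funext => z; rewrite (centered_sym z.1).
rewrite (dominated_fubini_swap dswap).
rewrite -(dominated_fubini centered_mul_mean_dominated).
exact: integral_centered_mul_mean.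
Qed.

Lemma centered_sq_dominated :
  dominated_kernel P (fun x y => centered K x y ^+ 2).
Proof.
split; first exact: jointly_measurableM centered_measurable centered_measurable.
exists (fun x => 2 * a x), (fun x => 2 * a x); split; try exact: rintegrableZ.
move=> x y; rewrite expr2 normrM ler_pM// ?centered_norm_le1//.
exact: centered_norm_le2.
Qed.

(** The integrand c^2 = c K - a (x) c - a (y) c + D c is at most
    D K - a (x) c - a (y) c + D c, whose last three terms integrate to 0 and
    whose first one integrates to D^2. *)
Lemma integral_centered_sq_le :
  \int[(P \x P)%E]_z centered K z.1 z.2 ^+ 2 <= D ^+ 2.
Proof.
have iK := rintegrableZ D (dominated_integrable pseudometric_dominated).
have ic := rintegrableZ D (dominated_integrable centered_dominated).
have i1 := dominated_integrable centered_mul_mean_dominated.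
have i2 : rintegrable (P \x P)%E (fun z => a z.2 * centered K z.1 z.2).
  rewrite (_ : (fun z => _) = fun z => a z.2 * centered K z.2 z.1).
    exact: dominated_integrable
      (dominated_kernel_swap centered_mul_mean_dominated).
  by apply/funext => z; rewrite (centered_sym z.1).
have ic2 := dominated_integrable centered_sq_dominated.
have i12 := rintegrableB iK i1; have i122 := rintegrableB i12 i2.
have i1222 := rintegrableD i122 ic.
apply: (le_trans (le_RintegralT ic2 i1222 _)).
  move=> z.
  have -> : centered K z.1 z.2 ^+ 2 = K z.1 z.2 * centered K z.1 z.2
      - a z.1 * centered K z.1 z.2 - a z.2 * centered K z.1 z.2
      + D * centered K z.1 z.2.
    by rewrite expr2 {1}/centered -/a -/D; ring.
  by rewrite !lerD2r mulrC ler_wpM2r// centered_le.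
rewrite RintegralDT// RintegralBT// RintegralBT// !RintegralZT; last 2 first.
- exact: dominated_integrable centered_dominated.
- exact: dominated_integrable pseudometric_dominated.
rewrite integral_centered_mul_mean integral_centered_mul_mean_swap.
rewrite (dominated_fubini pseudometric_dominated).
rewrite (dominated_fubini centered_dominated).
rewrite (_ : (fun x => \int[P]_y centered K x y) = fun=> 0); last first.
  by apply/funext => x; exact: centered_mean0.
by rewrite Rintegral_cstT mulr0 !subr0 addr0 expr2.
Qed.

(** Spreading the weight - W over the space balances a configuration of total
    weight W; the form of -K on the result is the form of -c on the original
    configuration. *)
Lemma opp_centered_positive_definite :
  positive_definite_on (fun t => t = 0) (fun x y => - K x y) ->
  positive_definite (fun x y => - centered K x y).
Proof.
move=> Kneg s _.
have oppE x : \int[P]_y - K x y = - a x.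
  by under eq_Rintegral do rewrite -mulN1r; rewrite RintegralZT// mulN1r.
have opp_sec x : rintegrable P (fun y => - K x y).
  have := rintegrableZ (-1) (Ksec x); congr (rintegrable _ _).
  by apply/funext => y; rewrite mulN1r.
have opp_mean : rintegrable P (fun x => \int[P]_y - K x y).
  have := rintegrableZ (-1) ia; congr (rintegrable _ _).
  by apply/funext => x; rewrite mulN1r oppE.
have opp_diag : rintegrable P (fun x => - K x x).
  rewrite (_ : (fun x => _) = fun=> 0); first exact: rintegrable_cst.
  by apply/funext => x; rewrite Kxx oppr0.
have opp_sym x y : - K x y = - K y x by rewrite (Ksym x y).
have := positive_definite_on_integral opp_sym Kneg opp_sec opp_mean opp_diag
  (addrN (total_weight s)).
have -> : (fun x => \int[P]_y - K x y) = fun x => -1 * a x.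
  by apply/funext => x; rewrite oppE mulN1r.
rewrite RintegralZT// -/(kernel_total K) -/D.
have -> : (fun x y => - centered K x y) =
    fun x y => (- K x y + (a x + a y)) + - D.
  by apply/funext => x; apply/funext => y; rewrite /centered -/a -/D; ring.
rewrite 2!quad_formD quad_form_sum1 quad_form_cst.
have -> : potential (fun x => -1 * a x) s = - potential a s.
  by rewrite /potential -sumrN; apply: eq_bigr => p _; ring.
by congr (0 <= _); ring.
Qed.

End Centering.

(** * Products of centred kernels *)

(** Cauchy-Schwarz, from the nonnegativity of the integral of (t f + g)^2 for
    every t. *)
Lemma sqr_Rintegral_mul_le d (T : measurableType d) (R : realType)
    (mu : {measure set T -> \bar R}) (f g : T -> R) :
  measurable_fun setT f -> measurable_fun setT g ->
  rintegrable mu (fun x => f x ^+ 2) -> rintegrable mu (fun x => g x ^+ 2) ->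
  (\int[mu]_x (f x * g x)) ^+ 2 <=
  (\int[mu]_x (f x ^+ 2)) * \int[mu]_x (g x ^+ 2).
Proof.
move=> mf mg f2 g2.
have fg : rintegrable mu (fun x => f x * g x).
  apply: rintegrable_le (rintegrableD f2 g2); first exact: measurable_funM.
  move=> x; rewrite ler_norml; apply/andP.
  have := sqr_ge0 (f x + g x); have := sqr_ge0 (f x - g x).
  have := sqr_ge0 (f x); have := sqr_ge0 (g x).
  have -> : (f x + g x) ^+ 2 = f x ^+ 2 + g x ^+ 2 + 2 * (f x * g x) by ring.
  have -> : (f x - g x) ^+ 2 = f x ^+ 2 + g x ^+ 2 - 2 * (f x * g x) by ring.
  by split; lra.
set A := \int[mu]_x (f x ^+ 2); set B := \int[mu]_x (f x * g x).
set C := \int[mu]_x (g x ^+ 2).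
have quad t : 0 <= t ^+ 2 * A + 2 * t * B + C.
  have i1 := rintegrableZ (t ^+ 2) f2; have i2 := rintegrableZ (2 * t) fg.
  rewrite /A /B /C -!RintegralZT// -!RintegralDT//; last exact: rintegrableD.
  apply: Rintegral_ge0 => x _.
  by have := sqr_ge0 (t * f x + g x); congr (0 <= _); ring.
have A0 : 0 <= A by apply: Rintegral_ge0 => x _; exact: sqr_ge0.
have [A00|An0] := eqVneq A 0.
  have [->|B0] := eqVneq B 0; first by rewrite expr0n/= A00 mul0r.
  have := quad (- (C + 1) / (2 * B)).
  rewrite A00 mulr0 add0r (_ : 2 * _ * B = - (C + 1)); last by field.
  by lra.
have := quad (- B / A).
rewrite (_ : _ + _ + C = (A * C - B ^+ 2) / A); last by field.
by rewrite pmulr_lge0 ?subr_ge0// invr_gt0 lt_neqAle eq_sym An0.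
Qed.

Lemma sqrt_mul_between (R : realType) (x A B p q : R) :
  0 <= p -> 0 <= q -> 0 <= A -> 0 <= B -> A <= p ^+ 2 -> B <= q ^+ 2 ->
  x ^+ 2 <= A * B ->
  `|x| <= Num.sqrt (A * B) /\ Num.sqrt (A * B) <= p * q.
Proof.
move=> p0 q0 A0 B0 Ap Bq xAB; split; first by rewrite -sqrtr_sqr ler_wsqrtr.
rewrite -[leRHS](ger0_norm (mulr_ge0 p0 q0)) -sqrtr_sqr ler_wsqrtr// exprMn.
exact: ler_pM.
Qed.

Section CrossIntegral.
Context d (T : measurableType d) (R : realType) (P : probability T R).
Variables K L : T -> T -> R.
Hypotheses (Kdist : integrable_pseudometric P K).
Hypotheses (Ldist : integrable_pseudometric P L).

Let a := kernel_mean P K.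
Let b := kernel_mean P L.
Let a_ge0 x : 0 <= a x := kernel_mean_ge0 Kdist x.
Let b_ge0 x : 0 <= b x := kernel_mean_ge0 Ldist x.
Let ia : rintegrable P a := kernel_mean_rintegrable Kdist.
Let ib : rintegrable P b := kernel_mean_rintegrable Ldist.

Let F x y := centered P K x y * centered P L x y.

Let F_norm_le x y : `|F x y| <= (2 * a x) * (2 * b y).
Proof.
rewrite normrM ler_pM//; first exact: centered_norm_le1.
exact: centered_norm_le2.
Qed.

Lemma centered_mul_dominated : dominated_kernel P F.
Proof.
split.
  exact: jointly_measurableM (centered_measurable Kdist)
    (centered_measurable Ldist).
exists (fun x => 2 * a x), (fun x => 2 * b x).
by split; try exact: rintegrableZ.
Qed.

(* Both factors of F x x are bounded by functions of the same point, so F x x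
   may fail to be integrable; bounding one mean function is enough. *)
Let truncation (n : nat) : set T := [set x | a x <= n%:R].

Let truncation_measurable n : measurable (truncation n).
Proof.
rewrite /truncation -[X in measurable X]setTI.
have := kernel_mean_measurable Kdist; rewrite -/a => ma.
have := ma measurableT _ (measurable_itv `]-oo, n%:R]).
by congr (measurable (_ `&` _)); apply/seteqP; split=> x /=; rewrite in_itv.
Qed.

Let w n x : R := \1_(truncation n) x.

Let w_norm_le1 n x : `|w n x| <= 1.
Proof. by rewrite /w indicE; case: (_ \in _); rewrite ?normr1 ?normr0. Qed.

Let w_measurable n : measurable_fun setT (w n).
Proof. exact: measurable_indic. Qed.

Let Fw n x y := w n x * w n y * F x y.

Let Fw_norm_le n x y : `|Fw n x y| <= `|F x y|.
Proof.
by rewrite /Fw !normrM ler_piMl// mulr_ile1.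
Qed.

Let Fw_measurable n : jointly_measurable (Fw n).
Proof.
apply: jointly_measurableM; last first.
  exact: dominated_measurable centered_mul_dominated.
apply: jointly_measurableM; first exact: jointly_measurable_fun1.
exact: jointly_measurable_fun2.
Qed.

Let Fw_dominated n : dominated_kernel P (Fw n).
Proof.
split=> //; exists (fun x => 2 * a x), (fun x => 2 * b x).
split; try exact: rintegrableZ.
by move=> x y; exact: le_trans (Fw_norm_le n x y) (F_norm_le x y).
Qed.

Let Fw_diag n : rintegrable P (fun x => Fw n x x).
Proof.
apply: (@rintegrable_le _ _ _ _ _ (fun x => 4 * n%:R * b x)).
- exact: jointly_measurable_diag.
- move=> x; rewrite /Fw /w indicE.
  have [/set_mem xn|] := boolP (x \in truncation n); last first.
    by rewrite !mul0r normr0 !mulr_ge0.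
  rewrite !mul1r (le_trans (F_norm_le x x))//.
  have -> : 2 * a x * (2 * b x) = 4 * (a x * b x) by ring.
  by rewrite -[leRHS]mulrA ler_wpM2l// ler_wpM2r.
- exact: rintegrableZ.
Qed.

(* The sequence is constant once n exceeds a z.1 and a z.2. *)
Let Fw_cvg z : (Fw n z.1 z.2)%:E @[n --> \oo] --> (F z.1 z.2)%:E.
Proof.
apply: cvg_near_cst.
pose N := Num.bound (Num.max (a z.1) (a z.2)).
have [aN1 aN2] : a z.1 <= N%:R /\ a z.2 <= N%:R.
  have : Num.max (a z.1) (a z.2) <= N%:R.
    by apply/ltW/archi_boundP; rewrite le_max a_ge0.
  by rewrite ge_max => /andP[].
near=> n.
have Nn : N%:R <= n%:R :> R by rewrite ler_nat; near: n; exact: nbhs_infty_ge.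
rewrite /Fw /w !indicE !mem_set ?mul1r//; rewrite /truncation/=.
- exact: le_trans aN2 Nn.
- exact: le_trans aN1 Nn.
Unshelve. all: by end_near.
Qed.

Hypothesis Kneg : positive_definite_on (fun t => t = 0) (fun x y => - K x y).
Hypothesis Lneg : positive_definite_on (fun t => t = 0) (fun x y => - L x y).

Let F_positive_definite : positive_definite F.
Proof.
rewrite (_ : F = fun x y => - centered P K x y * - centered P L x y);
  last first.
  by apply/funext => x; apply/funext => y; rewrite mulrNN.
apply: schur_product.
- by move=> x y; rewrite (centered_sym Kdist).
- by move=> x y; rewrite (centered_sym Ldist).
- exact: opp_centered_positive_definite.
- exact: opp_centered_positive_definite.
Qed.

Let Fw_integral_ge0 n : (0 <= \int[(P \x P)%E]_z (Fw n z.1 z.2)%:E)%E.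
Proof.
rewrite -EFin_Rintegral ?lee_fin; last exact: dominated_integrable.
rewrite dominated_fubini//; apply: positive_definite_integral_ge0.
- move=> x y; rewrite /Fw /F (centered_sym Kdist) (centered_sym Ldist).
  by rewrite (mulrC (w n x)).
- exact: positive_definite_reweight.
- by move=> x; exact: dominated_section.
- exact: dominated_integral_section.
- exact: Fw_diag.
Qed.

Lemma integral_centered_mul_ge0 :
  (0 <= \int[(P \x P)%E]_z (centered P K z.1 z.2 * centered P L z.1 z.2)%:E)%E.
Proof.
have Fd := centered_mul_dominated.
have [|||||_ _ lim] := @dominated_convergence _ _ _ (P \x P)%E setT
    measurableT (fun n z => (Fw n z.1 z.2)%:E) (fun z => (F z.1 z.2)%:E)
    (fun z => `|F z.1 z.2|%:E).
- by move=> n; apply/measurable_EFinP; exact: Fw_measurable.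
- by apply/measurable_EFinP; exact: dominated_measurable Fd.
- by apply: aeW => z _; exact: Fw_cvg.
- exact: rintegrable_norm (dominated_integrable Fd).
- by apply: aeW => z n _; rewrite lee_fin Fw_norm_le.
rewrite -(cvg_lim _ lim)//; apply: lime_ge; first exact: cvgP lim.
by apply: nearW => n; exact: Fw_integral_ge0.
Qed.

End CrossIntegral.

(** * Joint measurability of a separable metric *)

Lemma countable_bigcup_measurable d (T : sigmaRingType d) (I : Type)
    (D : set I) (F : I -> set T) : countable D ->
  (forall i, measurable (F i)) -> measurable (\bigcup_(i in D) F i).
Proof.
have [->|/set0P[r Dr]] := eqVneq D set0; first by rewrite bigcup_set0.
move=> /countable_injP[f finj] mF.
rewrite -(injpinv_image (cst r) finj) bigcup_image.
exact: bigcup_measurable.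
Qed.

Section SeparableMetric.
Context (R : realType) (S : pmetricType R).

Lemma ball_measurable (x : S) (r : R) :
  measurable ([set y | mdist x y < r] : set (borel S)).
Proof.
apply: sub_sigma_algebra; rewrite openE => y /= xyr.
apply/nbhs_ballP; exists (r - mdist x y); first by rewrite /= subr_gt0.
move=> z; rewrite ballEmdist/= => yz.
by rewrite (le_lt_trans (metric_triangle x y z))// -ltrBrDl.
Qed.

(** For c close to x and q slightly larger than the distance from c to x,
    the triangle inequality through c loses arbitrarily little. *)
Lemma mdist_lt_bigcup (C : set S) (r : R) : dense C ->
  [set z : S * S | mdist z.1 z.2 < r] =
  \bigcup_(p in C `*` [set: rat])
    ([set x | mdist p.1 x < ratr p.2] `*` [set y | mdist p.1 y < r - ratr p.2]).
Proof.
move=> denseC; apply/seteqP; split=> [[x y] /= xyr|]; last first.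
  move=> [x y] [[c q] /= _ [cxq cyq]].
  rewrite (le_lt_trans (metric_triangle x c y))// (metric_sym x c).
  by rewrite (_ : r = ratr q + (r - ratr q)) ?ltrD// addrC subrK.
pose e := (r - mdist x y) / 2.
have e0 : 0 < e by rewrite divr_gt0// subr_gt0.
have [c [xce Cc]] : ((ball x e)° `&` C) !=set0.
  apply: denseC; last exact: open_interior.
  by exists x; exact: nbhsx_ballx.
have {xce} : mdist x c < e by move/interior_subset: xce; rewrite ballEmdist.
move=> /rat_in_itvoo[q]; rewrite in_itv/= => /andP[xcq qe].
exists (c, q) => //=; split; first by rewrite metric_sym.
rewrite (le_lt_trans (metric_triangle c x y))// (metric_sym c x).
by move: qe; rewrite /e => qe; lra.
Qed.

(** Without separability the Borel sigma-algebra of the product may exceed the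
    product of the Borel sigma-algebras; a countable dense set exhibits the
    sublevel sets of the metric as countable unions of measurable rectangles. *)
Lemma mdist_jointly_measurable : separable S ->
  measurable_fun [set: borel S * borel S]
    (fun z : borel S * borel S => mdist (z.1 : S) (z.2 : S)).
Proof.
move=> [C countableC denseC].
apply: (measurability _ (RGenInftyO.measurableE R)) => _ [_ [r ->] <-].
rewrite setTI (_ : _ @^-1` _ = [set z : S * S | mdist z.1 z.2 < r]); last first.
  by apply/seteqP; split=> z /=; rewrite in_itv.
rewrite (mdist_lt_bigcup r denseC).
apply: countable_bigcup_measurable; first exact: countableX.
by move=> p; apply: measurableX; exact: ball_measurable.
Qed.

End SeparableMetric.

(** * Transfer to the underlying probability space *)

Lemma negative_type_positive_definite_on (R : realType) (S : metricType R) :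
  negative_type S ->
  positive_definite_on (fun t : R => t = 0) (fun x y : S => - mdist x y).
Proof.
move=> neg s s0.
have := neg (size s) (fun i => (tnth (in_tuple s) i).1)
  (fun i => (tnth (in_tuple s) i).2).
rewrite -(big_tnth _ _ s xpredT (fun p => p.2)) => /(_ s0).
rewrite -oppr_ge0; congr (0 <= _).
rewrite /quad_form [RHS]big_tnth -sumrN; apply: eq_bigr => i _.
rewrite [RHS]big_tnth -sumrN; apply: eq_bigr => j _.
by rewrite mulrN.
Qed.

Lemma positive_definite_on_comp (R : realFieldType) (T S : Type) (A : R -> Prop)
    (K : S -> S -> R) (f : T -> S) : positive_definite_on A K ->
  positive_definite_on A (fun x y => K (f x) (f y)).
Proof.
move=> Kpd s As; have := Kpd [seq (f p.1, p.2) | p <- s].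
rewrite /total_weight /quad_form !big_map => /(_ As); congr (0 <= _).
by apply: eq_bigr => p _; rewrite big_map.
Qed.

(** The change of variables is stated for a measure nu that takes the values of
    the image measure, not for the image measure itself, in order to apply to
    both marginals of a joint law and to its product with itself. Positive and
    negative parts are transferred separately, which covers every measurable
    f, integrable or not. *)
Lemma integral_law d d' (T : measurableType d) (T' : measurableType d')
    (R : realType) (mu : {measure set T -> \bar R})
    (nu : {measure set T' -> \bar R}) (phi : T -> T') (f : T' -> R) :
  measurable_fun setT phi -> measurable_fun setT f ->
  (forall A, measurable A -> nu A = mu (phi @^-1` A)) ->
  (\int[nu]_y (f y)%:E = \int[mu]_x (f (phi x))%:E)%E.
Proof.
move=> mphi /measurable_EFinP mf nuE.
have pos g : measurable_fun setT g -> (forall y, 0 <= g y)%E ->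
    (\int[nu]_y g y = \int[mu]_x g (phi x))%E.
  move=> mg g0; rewrite (eq_measure_integral (pushforward mu phi)).
    by rewrite ge0_integral_pushforward.
  by move=> A mA _; exact: nuE.
rewrite [LHS]integralE [RHS]integralE !pos//.
- by rewrite (funepos_comp (EFin \o f) phi) (funeneg_comp (EFin \o f) phi).
- exact: measurable_funeneg.
- exact: measurable_funepos.
Qed.

Section Transfer.
Context (R : realType) (SX SY : pmetricType R).
Context d (Omega : measurableType d) (P : probability Omega R).
Variables (X : {RV P >-> borel SX}) (Y : {RV P >-> borel SY}).

(** An independent copy is realised on Omega * Omega: the square of the joint
    law is the image of P \x P, as both agree on rectangles. *)
Lemma integral_joint_law2 (f : (SX * SY) * (SX * SY) -> R) :
  measurable_fun [set: (borel SX * borel SY) * (borel SX * borel SY)] f ->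
  (\int[joint_law P X Y \x joint_law P X Y]_z (f z)%:E =
   \int[P \x P]_w (f ((X w.1, Y w.1), (X w.2, Y w.2)))%:E)%E.
Proof.
move=> mf.
pose phi (w : Omega * Omega) : (borel SX * borel SY) * (borel SX * borel SY) :=
  (pair_fun X Y w.1, pair_fun X Y w.2).
have mphi : measurable_fun setT phi.
  apply: measurable_fun_pair.
    exact: measurableT_comp.
  exact: measurableT_comp.
apply: (integral_law (phi := phi) (f := f)) => // A mA.
apply: (@product_measure_unique _ _ _ _ _ _ _ (pushforward (P \x P)%E phi));
  rewrite // => B C mB mC.
rewrite -[LHS]/((P \x P)%E ((pair_fun X Y @^-1` B) `*` (pair_fun X Y @^-1` C))).
by rewrite product_measure1E//; exact: measurable_funPTI.
Qed.

End Transfer.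

Section MetricLaw.
Context (R : realType) (S : pmetricType R).
Hypothesis sepS : separable S.
Implicit Type Q : probability (borel S) R.

Lemma mdist_measurable (x : S) :
  measurable_fun [set: borel S] (fun y : borel S => mdist x (y : S)).
Proof. exact: jointly_measurable_section (mdist_jointly_measurable sepS). Qed.

Lemma amu_measurable Q : measurable_fun [set: borel S] (amu Q).
Proof.
apply: (measurableT_comp (f := fine)) => //.
apply: (measurable_fun_fubini_tonelli_F
    (fun z : borel S * borel S => (mdist (z.1 : S) (z.2 : S))%:E)).
  by apply/measurable_EFinP; exact: mdist_jointly_measurable.
by move=> z; rewrite lee_fin mdist_ge0.
Qed.

Lemma dmu_measurable Q :
  measurable_fun [set: borel S * borel S]
    (fun z : borel S * borel S => dmu Q z.1 z.2).
Proof.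
apply: measurable_funD => //; apply: measurable_funB.
  apply: measurable_funB; first exact: mdist_jointly_measurable.
  exact: jointly_measurable_fun1 (amu_measurable Q).
exact: jointly_measurable_fun2 (amu_measurable Q).
Qed.

Context d (Omega : measurableType d) (P : probability Omega R).
Variable Z : {RV P >-> borel S}.

Definition pullback_dist (w w' : Omega) : R := mdist (Z w : S) (Z w' : S).

Lemma pullback_integrable_pseudometric Q :
  (forall A, measurable A -> Q A = P (Z @^-1` A)) -> M11 Q ->
  integrable_pseudometric P pullback_dist.
Proof.
move=> QE [ o]; rewrite /pullback_dist.
have mo : measurable_fun [set: borel S] (fun y : borel S => mdist (y : S) o).
  rewrite (_ : (fun y => _) = fun y : borel S => mdist o (y : S)).
    exact: mdist_measurable.
  by apply/funext => y; exact: metric_sym.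
rewrite (integral_law (mu := P) (phi := Z) _ mo)// => Zo.
have io : rintegrable P (fun w => mdist (Z w : S) o).
  apply/integrableP; split.
    by apply/measurable_EFinP; exact: (measurableT_comp mo).
  by under eq_integral => w _ do rewrite /= ger0_norm ?mdist_ge0//.
split.
- have mZ2 : measurable_fun [set: Omega * Omega]
      (fun w : Omega * Omega => (Z w.1, Z w.2)).
    by apply: measurable_fun_pair; exact: measurableT_comp.
  exact: (measurableT_comp (mdist_jointly_measurable sepS) mZ2).
- by move=> w; exact: mdistxx.
- by move=> w w'; exact: metric_sym.
- by move=> w1 w2 w3; exact: metric_triangle.
- move=> w; apply: (@rintegrable_le _ _ _ _ _
    (fun w' => mdist (Z w : S) o + mdist (Z w' : S) o)).
  + exact: (measurableT_comp (mdist_measurable (Z w))).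
  + move=> w'; rewrite ger0_norm ?mdist_ge0// (metric_sym (Z w' : S) o).
    exact: metric_triangle.
  + exact: rintegrableD (rintegrable_cst P _) io.
Qed.

Variable Q : probability (borel S) R.
Hypothesis QE : forall A, measurable A -> Q A = P (Z @^-1` A).

Lemma amu_pullback w : amu Q (Z w : S) = kernel_mean P pullback_dist w.
Proof.
rewrite /amu /Rintegral.
by rewrite (integral_law (mu := P) (phi := Z) _ (mdist_measurable (Z w))).
Qed.

Lemma Dmu_pullback : Dmu Q = kernel_total P pullback_dist.
Proof.
rewrite /Dmu /Rintegral.
rewrite (integral_law (mu := P) (phi := Z) _ (amu_measurable Q))//.
by congr fine; apply: eq_integral => w _; rewrite amu_pullback.
Qed.

Lemma dmu_pullback w w' :
  dmu Q (Z w : S) (Z w' : S) = centered P pullback_dist w w'.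
Proof. by rewrite /dmu !amu_pullback Dmu_pullback. Qed.

End MetricLaw.

(** Both marginals of the law of (X, X) are the law of X, so with Y = X the
    formula gives the distance variance as the integral of a square over the
    same space Omega * Omega. *)
Lemma dcovE (R : realType) (SX SY : pmetricType R)
    d (Omega : measurableType d) (P : probability Omega R)
    (X : {RV P >-> borel SX}) (Y : {RV P >-> borel SY}) :
  separable SX -> separable SY ->
  dcov P X Y = (\int[P \x P]_w (centered P (pullback_dist X) w.1 w.2
    * centered P (pullback_dist Y) w.1 w.2)%:E)%E.
Proof.
move=> sepX sepY; rewrite /dcov /dcov_law unlock integral_joint_law2.
  apply: eq_integral => w _ /=.
  by rewrite (dmu_pullback sepX (Z := X))// (dmu_pullback sepY (Z := Y)).
set Q1 := marginal1 _; set Q2 := marginal2 _.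
have m1 : measurable_fun setT
    (fun z : (borel SX * borel SY) * (borel SX * borel SY) =>
      (z.1.1, z.2.1)).
  by apply: measurable_fun_pair; apply: measurableT_comp.
have m2 : measurable_fun setT
    (fun z : (borel SX * borel SY) * (borel SX * borel SY) =>
      (z.1.2, z.2.2)).
  by apply: measurable_fun_pair; apply: measurableT_comp.
apply: measurable_funM.
- exact: (measurableT_comp (dmu_measurable sepX Q1) m1).
- exact: (measurableT_comp (dmu_measurable sepY Q2) m2).
Qed.

Lemma dcovxxE (R : realType) (S : pmetricType R)
    d (Omega : measurableType d) (P : probability Omega R)
    (X : {RV P >-> borel S}) :
  separable S -> integrable_pseudometric P (pullback_dist X) ->
  dcov P X X =
  (\int[(P \x P)%E]_w centered P (pullback_dist X) w.1 w.2 ^+ 2)%:E.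
Proof.
move=> sepS dX.
rewrite dcovE// EFin_Rintegral; last first.
  exact: dominated_integrable (centered_sq_dominated dX).
by apply: eq_integral => w _; rewrite expr2.
Qed.

Local Open Scope ereal_scope.

Theorem theorem4p1 (R : realType) (SX SY : pmetricType R)
    (sepX : separable SX) (sepY : separable SY)
    (d : measure_display) (Omega : measurableType d) (P : probability Omega R)
    (X : {RV P >-> borel SX}) (Y : {RV P >-> borel SY}) :
  let theta := joint_law P X Y in
  let mu := marginal1 theta in
  let nu := marginal2 theta in
  M111 theta ->
  (`|dcov P X Y| <= sqrte (dcov P X X * dcov P Y Y) /\
   sqrte (dcov P X X * dcov P Y Y) <= (Dmu mu * Dmu nu)%:E) /\
  (negative_type SX -> negative_type SY -> 0 <= dcov P X Y).
Proof.
move=> theta mu nu [M11mu M11nu].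
have dX : integrable_pseudometric P (pullback_dist X).
  exact: (pullback_integrable_pseudometric (Q := mu) sepX).
have dY : integrable_pseudometric P (pullback_dist Y).
  exact: (pullback_integrable_pseudometric (Q := nu) sepY).
rewrite (Dmu_pullback (Z := X) (Q := mu) sepX)//.
rewrite (Dmu_pullback (Z := Y) (Q := nu) sepY)//.
split; last first.
  move=> negX negY; rewrite dcovE//; apply: integral_centered_mul_ge0 => //.
  - exact: (positive_definite_on_comp X
      (negative_type_positive_definite_on negX)).
  - exact: (positive_definite_on_comp Y
      (negative_type_positive_definite_on negY)).
rewrite (dcovxxE sepX dX) (dcovxxE sepY dY) dcovE//.
rewrite -(EFin_Rintegral (dominated_integrable (centered_mul_dominated dX dY))).
rewrite -EFinM /= !lee_fin.
apply: (sqrt_mul_between (kernel_total_ge0 dX) (kernel_total_ge0 dY)).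
- by apply: Rintegral_ge0 => z _; exact: sqr_ge0.
- by apply: Rintegral_ge0 => z _; exact: sqr_ge0.
- exact: integral_centered_sq_le.
- exact: integral_centered_sq_le.
- exact: (sqr_Rintegral_mul_le (centered_measurable dX) (centered_measurable dY)
    (dominated_integrable (centered_sq_dominated dX))
    (dominated_integrable (centered_sq_dominated dY))).
Qed.
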